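(* Let $A$ be a commutative, unital, complex Banach algebra with dense invertible group and let $\alpha(x)$ be a monic polynomial over $A$. Then $G(A_\alpha)$ is dense in $A_\alpha$, where $A_\alpha$ is the Arens–Hoffman extension of $A$ by $\alpha(x)$.
   Context: $G(B)$ denotes the group of invertible elements of a unital algebra $B$; a normed algebra $B$ has dense invertible group if $G(B)$ is dense in $B$. Monic polynomials have degree $n\ge1$. For $\alpha(x)=a_0+\cdots+a_{n-1}x^{n-1}+x^n$, the Arens–Hoffman extension is $A_\alpha=A[x]/(\alpha(x))$; writing $\bar x$ for the coset of $x$, each element is uniquely $\sum_{k=0}^{n-1}b_k\bar x^k$ with $b_k\in A$, and it is normed by $\|\sum_{k=0}^{n-1}b_k\bar x^k\|=\sum_{k=0}^{n-1}\|b_k\|t^k$ for a fixed $t>0$ with $t^n\ge\sum_{k=0}^{n-1}\|a_k\|t^k$. *)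

(* Defs.v *)
From HB Require Import structures.
From mathcomp Require Import all_boot all_order all_algebra.
From mathcomp Require Import qpoly complex.
From mathcomp Require Import all_classical all_reals all_analysis.

Set Implicit Arguments.
Unset Strict Implicit.
Unset Printing Implicit Defensive.

Import Order.TTheory GRing.Theory Num.Theory.
Import numFieldNormedType.Exports.

Local Open Scope classical_set_scope.
Local Open Scope ring_scope.

(* A telescope rather than an HB structure: Hierarchy Builder cannot join
   [GRing.ComAlgebra] and [NormedModule], because [Num.NumDomain] is a ring
   normed by itself.  As in the library, norms take their values in the scalar
   field; for the scalar field R[i] the order makes them nonnegative reals.
   The normalisation [`|1| = 1] is not required. *)
Record comNormedAlg (K : numFieldType) := ComNormedAlg {
  cna_alg : comAlgType K;
  cna_norm : cna_alg -> K;
  cna_normD : forall x y, cna_norm (x + y) <= cna_norm x + cna_norm y;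
  cna_normZ : forall c x, cna_norm (c *: x) = `|c| * cna_norm x;
  cna_norm_eq0 : forall x, cna_norm x = 0 -> x = 0;
  cna_normM : forall x y, cna_norm (x * y) <= cna_norm x * cna_norm y
}.

Definition cna_sort (K : numFieldType) (B : comNormedAlg K) : Type := cna_alg B.
Coercion cna_sort : comNormedAlg >-> Sortclass.

HB.instance Definition _ (K : numFieldType) (B : comNormedAlg K) :=
  GRing.ComAlgebra.copy (cna_sort B) (cna_alg B).

HB.instance Definition _ (K : numFieldType) (B : comNormedAlg K) :=
  Lmodule_isNormed.Build K (cna_sort B)
    (@cna_normD K B) (@cna_normZ K B) (@cna_norm_eq0 K B).

Lemma normrM_le (K : numFieldType) (B : comNormedAlg K) (x y : B) :
  `|x * y| <= `|x| * `|y|.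
Proof. exact: cna_normM. Qed.

Record comBanachAlg (K : numFieldType) := ComBanachAlg {
  cba_alg :> comNormedAlg K;
  cba_complete : forall F : set_system cba_alg,
    ProperFilter F -> cauchy F -> cvg F
}.

(* [GRing.unit] would require a [unitRingType] structure on [B]. *)
Definition invertible_group (B : nzRingType) : set B :=
  [set b | exists c : B, b * c = 1 /\ c * b = 1].
Arguments invertible_group B : clear implicits.

Definition dense_invertible_group (K : numFieldType) (B : comNormedAlg K) :=
  dense (invertible_group B).

Section ArensHoffmanAlgebra.
Variables (K : numFieldType) (A : comNormedAlg K) (alpha : {poly A}).

(* {poly %/ alpha} represents a coset by its unique element of degree less than
   that of [alpha].  The library makes it an A-algebra; this copy carries
   instead the K-algebra structure obtained by restricting the scalars. *)
Definition ah_type : Type := {poly %/ alpha}.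

HB.instance Definition _ := GRing.ComNzRing.copy ah_type {poly %/ alpha}.

Definition ah_scale (c : K) (b : ah_type) : ah_type :=
  c%:A *: (b : {poly %/ alpha}).

Fact ah_scaleA c d b : ah_scale c (ah_scale d b) = ah_scale (c * d) b.
Proof. by rewrite /ah_scale scalerA -scalerAl mul1r scalerA. Qed.

Fact ah_scale1 : left_id 1 ah_scale.
Proof. by move=> b; rewrite /ah_scale !scale1r. Qed.

Fact ah_scaleDr : right_distributive ah_scale +%R.
Proof. by move=> c b b'; rewrite /ah_scale scalerDr. Qed.

Fact ah_scaleDl b : {morph ah_scale^~ b : c d / c + d}.
Proof. by move=> c d; rewrite /ah_scale !scalerDl. Qed.

HB.instance Definition _ := GRing.Zmodule_isLmodule.Build K ah_type
  ah_scaleA ah_scale1 ah_scaleDr ah_scaleDl.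

Fact ah_scaleAl (c : K) (b b' : ah_type) : c *: (b * b') = (c *: b) * b'.
Proof. exact: (@scalerAl A {poly %/ alpha}). Qed.

HB.instance Definition _ := GRing.Lmodule_isLalgebra.Build K ah_type ah_scaleAl.
HB.instance Definition _ := GRing.Lalgebra_isComAlgebra.Build K ah_type.

Definition ah_norm (t : K) (b : ah_type) : K :=
  \sum_(k < (size alpha).-1) `|(b : {poly A})`_k| * t ^+ k.

End ArensHoffmanAlgebra.

Section ArensHoffman.
Variables (K : numFieldType) (A : comNormedAlg K) (alpha : {poly A}) (t : K).
Hypotheses (alpha_monic : alpha \is monic) (alpha_gt1 : (1 < size alpha)%N).
Local Notation n := (size alpha).-1.
Local Notation AH := (ah_type alpha).
Hypotheses (t_gt0 : 0 < t)
  (t_bound : \sum_(k < n) `|alpha`_k| * t ^+ k <= t ^+ n).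

Let t_ge0 : 0 <= t. Proof. exact: ltW. Qed.

Let n_gt0 : (0 < n)%N. Proof. by case: (size alpha) alpha_gt1 => [|[]]. Qed.

Let size_alpha : size alpha = n.+1.
Proof. by rewrite prednK// ltnW. Qed.

Let mk_alpha : mk_monic alpha = alpha.
Proof. by rewrite /mk_monic alpha_gt1 alpha_monic. Qed.

Let ah_size (b : AH) : (size (b : {poly A}) <= n)%N.
Proof.
rewrite -ltnS -size_alpha (leq_trans (size_mk_monic (b : {poly %/ alpha})))//.
by rewrite mk_alpha.
Qed.

Fact ah_normD (b b' : AH) : ah_norm t (b + b') <= ah_norm t b + ah_norm t b'.
Proof.
rewrite /ah_norm -big_split/=; apply: ler_sum => k _.
by rewrite coefD -mulrDl ler_wpM2r ?exprn_ge0 ?ler_normD.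
Qed.

Fact ah_normZ (c : K) (b : AH) : ah_norm t (c *: b) = `|c| * ah_norm t b.
Proof.
rewrite /ah_norm mulr_sumr; apply: eq_bigr => k _.
by rewrite coefZ -scalerAl mul1r normrZ mulrA.
Qed.

Fact ah_norm_eq0 (b : AH) : ah_norm t b = 0 -> b = 0.
Proof.
move=> /eqP; rewrite psumr_eq0 => [/allP b0|k _]; last first.
  by rewrite mulr_ge0 ?exprn_ge0.
apply/val_inj/polyP => k; rewrite coef0.
have [kn|nk] := ltnP k n; last by rewrite nth_default// (leq_trans (ah_size b)).
have := b0 (Ordinal kn) (mem_index_enum _).
by rewrite /= mulf_eq0 expf_eq0 (gt_eqF t_gt0) andbF orbF normr_eq0 => /eqP.
Qed.

Let ah_normC (a : A) (b : AH) :
  ah_norm t (a *: (b : {poly %/ alpha}) : AH) <= `|a| * ah_norm t b.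
Proof.
rewrite /ah_norm mulr_sumr; apply: ler_sum => k _.
by rewrite coefZ mulrA ler_wpM2r ?exprn_ge0 ?normrM_le.
Qed.

Let X : AH := in_qpoly alpha 'X.

Let ah_reprK (b : AH) : in_qpoly alpha (b : {poly A}) = b.
Proof. by apply: val_inj; exact/in_qpoly_small/size_mk_monic. Qed.

Let ah_XM (b : AH) :
  (X * b : AH) = 'X * (b : {poly A}) - (b : {poly A})`_n.-1 *: alpha :> {poly A}.
Proof.
have -> : (X * b : AH) = in_qpoly alpha ('X * (b : {poly A})).
  by rewrite in_qpolyM ah_reprK.
set p := _ - _.
have -> : 'X * (b : {poly A}) = p + (b : {poly A})`_n.-1 *: alpha.
  by rewrite /p subrK.
rewrite in_qpolyD in_qpolyZ.
have -> : in_qpoly alpha alpha = 0.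
  by apply: val_inj; rewrite /= mk_alpha Pdiv.RingMonic.rmodpp.
rewrite scaler0 addr0 in_qpoly_small// mk_alpha size_alpha ltnS.
apply/leq_sizeP => j nj; rewrite coefB coefXM coefZ.
rewrite (gtn_eqF (leq_trans n_gt0 nj)).
move: nj; rewrite leq_eqVlt => /predU1P[<-|nj].
  by rewrite -[alpha`_n]lead_coefE (monicP alpha_monic) mulr1 subrr.
have -> : alpha`_j = 0 by apply: nth_default; rewrite size_alpha.
rewrite mulr0 subr0; apply: nth_default; apply: leq_trans (ah_size b) _.
by rewrite -ltnS (ltn_predK nj).
Qed.

Let ah_normXM (b : AH) : ah_norm t (X * b) <= t * ah_norm t b.
Proof.
rewrite /ah_norm ah_XM; move: t_bound n_gt0.
case: (n) => // m bound _.
set p : {poly A} := b.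
have -> : t * (\sum_(k < m.+1) `|p`_k| * t ^+ k) =
    \sum_(k < m.+1) `|('X * p)`_k| * t ^+ k + `|p`_m| * t ^+ m.+1.
  rewrite mulr_sumr big_ord_recr [in RHS]big_ord_recl/=.
  rewrite coefXM/= normr0 mul0r add0r.
  congr (_ + _); last by rewrite mulrCA -exprS.
  by apply: eq_bigr => k _; rewrite coefXM/= mulrCA -exprS.
apply: le_trans (lerD (lexx _) (ler_wpM2l (normr_ge0 _) bound)).
rewrite mulr_sumr -big_split/=; apply: ler_sum => k _.
rewrite mulrA -mulrDl ler_wpM2r ?exprn_ge0// coefB coefZ.
by rewrite (le_trans (ler_normB _ _))// lerD2l normrM_le.
Qed.

Let ah_normXnM (b : AH) i : ah_norm t (X ^+ i * b) <= t ^+ i * ah_norm t b.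
Proof.
elim: i => [|i IH]; first by rewrite !expr0 !mul1r.
by rewrite !exprS -!mulrA (le_trans (ah_normXM _))// ler_wpM2l.
Qed.

Let ah_decomp (b : AH) :
  b = \sum_(k < n) (b : {poly A})`_k *: (X ^+ k : {poly %/ alpha}) :> AH.
Proof.
have bE : (b : {poly A}) = \poly_(k < n) (b : {poly A})`_k.
  apply/polyP => k; rewrite coef_poly; case: ltnP => // nk.
  by rewrite nth_default// (leq_trans (ah_size b)).
rewrite -[LHS]ah_reprK {1}bE poly_def raddf_sum/=; apply: eq_bigr => k _.
by rewrite in_qpolyZ rmorphXn.
Qed.

Let ah_norm_sum (I : Type) (r : seq I) (F : I -> AH) :
  ah_norm t (\sum_(i <- r) F i) <= \sum_(i <- r) ah_norm t (F i).
Proof.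
elim/big_ind2: _ => [|x u y v xu yv|//]; last first.
  by rewrite (le_trans (ah_normD _ _))// lerD.
by rewrite /ah_norm big1// => k _; rewrite coef0 normr0 mul0r.
Qed.

Fact ah_normM (b b' : AH) : ah_norm t (b * b') <= ah_norm t b * ah_norm t b'.
Proof.
rewrite {1}(ah_decomp b) mulr_suml [leRHS]mulr_suml.
apply: le_trans (ah_norm_sum _ _) _; apply: ler_sum => k _.
rewrite -(@scalerAl A {poly %/ alpha}).
by rewrite (le_trans (ah_normC _ _))// -mulrA ler_wpM2l.
Qed.

(* When [alpha] is not monic of positive degree, {poly %/ alpha} is by
   convention the quotient by 'X: the hypotheses [alpha_monic] and [alpha_gt1]
   rule this out. *)
Definition arens_hoffman : comNormedAlg K :=
  ComNormedAlg ah_normD ah_normZ ah_norm_eq0 ah_normM.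

Lemma ah_normE (b : arens_hoffman) :
  `|b| = \sum_(k < n) `|((b : AH) : {poly A})`_k| * t ^+ k.
Proof. by []. Qed.

End ArensHoffman.

(* Main.v *)
Require Import Defs.
From mathcomp Require Import all_boot all_order all_algebra.
From mathcomp Require Import qpoly complex ring.
From mathcomp Require Import all_classical all_reals all_analysis.

(** Invertibility in the extension reduces to invertibility in A of a value of
    a polynomial.  An element b of A_alpha is integral over A, so p(b) = 0 for
    some monic p over A.  For h in A, b - h divides p(b) - p(h) = - p(h), hence
    b - h is invertible as soon as p(h) is ([integral_sub_invertible]).  Since
    the embedding of A in A_alpha is isometric, it suffices to find arbitrarily
    small h in A with p(h) invertible.

    This holds for every p whose leading coefficient is invertible
    ([poly_invertible_value]), by induction on the degree.  The derivative p'
    has smaller degree, and its leading coefficient is still invertible because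
    A contains the rationals; so after a small perturbation of the base point c,
    p'(c) is invertible.  By the inverse function theorem the values of p near c
    then fill a neighbourhood of p(c) ([poly_local_surjection]), which contains
    an invertible element because G(A) is dense.  The inverse function theorem
    is where completeness enters: p(c + h) = y is rewritten as a fixed-point
    equation for h, solved by a contraction of a small ball. *)

Set Implicit Arguments.
Unset Strict Implicit.
Unset Printing Implicit Defensive.

Import Order.TTheory GRing.Theory Num.Theory.
Import numFieldNormedType.Exports.

Local Open Scope classical_set_scope.
Local Open Scope ring_scope.

(** * Density and invertibility *)

Lemma dense_normP (K : numFieldType) (V : normedModType K) (S : set V) :
  dense S <->
  forall (x : V) (e : K), 0 < e -> exists2 y, S y & `|x - y| < e.
Proof.
split=> [dS x e e0|dS O [x Ox] oO].
  have [|y [xy Sy]] := dS (ball x e) _ (ball_open x e).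
    by exists x; exact: ballxx.
  by exists y => //; rewrite -ball_normE in xy.
have /nbhs_ballP[e /= e0 eO] : nbhs x O by exact: open_nbhs_nbhs.
have [y Sy xy] := dS x e e0.
by exists y; split=> //; apply: eO; rewrite -ball_normE.
Qed.

Lemma invertible_com (B : comNzRingType) (b : B) :
  invertible_group B b <-> exists c, b * c = 1.
Proof.
by split=> [[c [bc _]]|[c bc]]; exists c => //; rewrite [c * b]mulrC.
Qed.

Lemma invertible_divisor (B : comNzRingType) (a b : B) :
  invertible_group B (a * b) -> invertible_group B a.
Proof.
move=> /invertible_com[c abc]; apply/invertible_com.
by exists (b * c); rewrite mulrA.
Qed.

(** * A fixed-point theorem over the complex numbers *)

(** Norms take values in R[i], whose order is partial; but its nonnegative
    elements are real, and the Archimedean property of R applies to them. *)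
Lemma exists_half_exp_lt (R : realType) (r e : R[i]) :
  0 <= r -> 0 < e -> exists n, r * 2^-1 ^+ n < e.
Proof.
move=> r0 e0.
have re0 : 0 <= r / e by rewrite divr_ge0// ltW.
have /complex_realP[x xE] := ger0_real re0.
exists (Num.bound x); rewrite exprVn ltr_pdivrMr ?exprn_gt0//.
rewrite mulrC -ltr_pdivrMr// xE.
have := upper_nthrootP (leqnn (Num.bound x)).
by rewrite -ltcR rmorphXn rmorph_nat.
Qed.

(** The bound on T 0 makes T map the ball of radius r into itself.  Hence every
    point of the orbit of 0 is within r of 0, and applying T^n shows that the
    orbit from its n-th point on stays within r / 2^n of that point. *)
Lemma half_contraction_fixpoint (R : realType) (A : comBanachAlg R[i])
    (T : A -> A) (r : R[i]) :
  0 < r -> `|T 0| <= r / 2 ->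
  (forall x y, `|x| <= r -> `|y| <= r -> `|T x - T y| <= `|x - y| / 2) ->
  exists2 x, `|x| <= r & T x = x.
Proof.
move=> r0 T0 lipT.
pose u n := iter n T 0.
have halfr : r / 2 + r / 2 = r by rewrite -splitr.
have norm0r : `|0 : A| <= r by rewrite normr0 ltW.
have ur n : `|u n| <= r.
  elim: n => [//|n IH]; rewrite -(subrK (T 0) (u n.+1)).
  rewrite (le_trans (ler_normD _ _))// -[leRHS]halfr lerD//.
  apply: le_trans (lipT _ _ IH norm0r) _.
  by rewrite subr0 ler_pM2r ?invr_gt0.
have dist_u n m : `|u n - u (n + m)%N| <= r * 2^-1 ^+ n.
  elim: n => [|n IH]; first by rewrite add0n expr0 mulr1 sub0r normrN.
  rewrite addSn (le_trans (lipT _ _ _ _))// exprSr mulrA.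
  by rewrite ler_pM2r ?invr_gt0.
have dist_small e : 0 < e -> exists n, r * 2^-1 ^+ n < e.
  exact: exists_half_exp_lt (ltW r0).
have cvgu : cvg (u @ \oo).
  apply: cba_complete; apply: cauchy_exP => e e0.
  have [n ne] := dist_small e e0.
  exists (u n); exists n => // m /= nm.
  by rewrite -ball_normE/= -(subnKC nm) (le_lt_trans (dist_u _ _)).
have /cvg_ex[l ul] := cvgu.
(* The closed bound of [dist_u] passes to the limit; at n = 0 it puts l in the
   ball. *)
have dist_l n : `|u n - l| <= r * 2^-1 ^+ n.
  apply/ler_addgt0Pr => e e0.
  have /cvgrPdist_lt/(_ e e0)[N _ uN] := ul.
  have := uN (n + N)%N (leq_addl _ _) => /= lu.
  rewrite -(subrKA (u (n + N)%N)) (le_trans (ler_normD _ _))//.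
  by rewrite lerD// distrC ltW.
have lr : `|l| <= r.
  by have := dist_l 0%N; rewrite expr0 mulr1 sub0r normrN.
exists l => //; apply/eqP; rewrite -subr_eq0 -normr_le0.
apply/ler_addgt0Pr => e e0; rewrite add0r.
have [n ne] := dist_small e e0.
rewrite -(subrKA (u n.+1)) (le_trans (ler_normD _ _))//.
apply: le_trans (ltW ne).
have -> : r * 2^-1 ^+ n = r * 2^-1 ^+ n / 2 + r * 2^-1 ^+ n / 2.
  by rewrite -splitr.
rewrite lerD//; last by rewrite -mulrA -exprSr.
by rewrite distrC (le_trans (lipT _ _ _ _))// ler_pM2r ?invr_gt0.
Qed.

(** * The inverse function theorem for polynomials *)

Lemma poly_bounded_lipschitz (K : numFieldType) (A : comNormedAlg K)
    (p : {poly A}) :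
  exists2 M : K, 0 <= M & forall h k : A, `|h| <= 1 -> `|k| <= 1 ->
    `|p.[h]| <= M /\ `|p.[h] - p.[k]| <= M * `|h - k|.
Proof.
elim/poly_ind: p => [|p c [M M0 Mp]].
  by exists 0 => // h k _ _; rewrite !horner0 subrr normr0 mul0r.
exists (M + M + `|c|) => [|h k h1 k1]; first by rewrite !addr_ge0.
have [ph phk] := Mp h k h1 k1; have [pk _] := Mp k k k1 k1.
rewrite !hornerMXaddC; split.
  rewrite (le_trans (ler_normD _ _))// lerD// -[leLHS]addr0 lerD//.
  by rewrite (le_trans (normrM_le _ _))// -[leRHS]mulr1 ler_pM.
have -> : p.[h] * h + c - (p.[k] * k + c) =
    (p.[h] - p.[k]) * h + p.[k] * (h - k) by ring.
rewrite (le_trans (ler_normD _ _))// [leRHS]mulrDl -[leLHS]addr0.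
apply: lerD; last by rewrite mulr_ge0.
rewrite [leRHS]mulrDl; apply: lerD; last first.
  by rewrite (le_trans (normrM_le _ _))// ler_wpM2r.
by rewrite (le_trans (normrM_le _ _))// -[leRHS]mulr1 ler_pM.
Qed.

(** Splitting off the affine part leaves s(x) x^2, whose increments carry an
    extra factor r: on a small ball p differs from its linearization by a map
    with a small Lipschitz constant. *)
Lemma poly_second_order (K : numFieldType) (A : comNormedAlg K)
    (p : {poly A}) :
  exists2 M : K, 0 <= M & forall (r : K) (h k : A), r <= 1 ->
    `|h| <= r -> `|k| <= r ->
    `|(p.[h] - p.[k]) - p`_1 * (h - k)| <= M * r * `|h - k|.
Proof.
pose s := drop_poly 2 p.
have pE x : p.[x] = p`_0 + p`_1 * x + s.[x] * x ^+ 2.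
  rewrite -[in LHS](poly_take_drop 2 p) hornerD hornerM hornerXn.
  by rewrite horner_poly !big_ord_recl big_ord0 addr0 expr0 expr1 mulr1.
have [M M0 Ms] := poly_bounded_lipschitz s.
exists (M + (M + M)) => [|r h k r1 hr kr]; first by rewrite !addr_ge0.
have h1 := le_trans hr r1; have k1 := le_trans kr r1.
have [_ shk] := Ms h k h1 k1; have [sk _] := Ms k k k1 k1.
have r0 : 0 <= r by exact: le_trans hr.
rewrite !pE.
have -> : p`_0 + p`_1 * h + s.[h] * h ^+ 2 - (p`_0 + p`_1 * k + s.[k] * k ^+ 2)
    - p`_1 * (h - k) =
    (s.[h] - s.[k]) * (h * h) + s.[k] * (h + k) * (h - k) by ring.
rewrite (le_trans (ler_normD _ _))// [in leRHS]mulrDl [leRHS]mulrDl lerD//.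
  rewrite (le_trans (normrM_le _ _))// mulrAC ler_pM//.
  by rewrite (le_trans (normrM_le _ _))// -[leRHS]mulr1 ler_pM.
rewrite (le_trans (normrM_le _ _))// ler_wpM2r//.
rewrite (le_trans (normrM_le _ _))// [leRHS]mulrDl -mulrDr ler_pM//.
by rewrite (le_trans (ler_normD _ _))// lerD.
Qed.


(** A minimum would do in a total order.  The norms considered here take values
    in a partially ordered field, where the inverse of a sum of positive
    quantities is a common lower bound of their inverses. *)
Lemma exists_small (K : numFieldType) (a C : K) :
  0 < a -> 0 <= C -> exists2 r, 0 < r & [/\ r <= 1, r <= a & C * r <= 1].
Proof.
move=> a0 C0; pose s := 1 + a^-1 + C.
have s0 : 0 < s by rewrite ltr_pwDl// ltr_pwDl// invr_ge0 ltW.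
have le_s x : x <= s -> x / s <= 1 by move=> xs; rewrite ler_pdivrMr// mul1r.
exists s^-1; first by rewrite invr_gt0.
have a'0 : 0 <= a^-1 by rewrite invr_ge0 ltW.
split; last by rewrite le_s// lerDr addr_ge0.
- by rewrite -[s^-1]mul1r le_s// /s -addrA lerDl addr_ge0.
- rewrite -[leRHS]mulr1 -ler_pdivrMl// le_s// /s addrAC lerDr.
  by rewrite addr_ge0.
Qed.

(** With u the inverse of p'(c), the equation p(c + h) = y says that h is fixed
    by the Newton-like map h |-> h - u (p(c + h) - y), which contracts a small
    ball because its linear part at 0 vanishes. *)
Lemma poly_local_surjection (R : realType) (A : comBanachAlg R[i])
    (p : {poly A}) (c : A) (e : R[i]) :
  0 < e -> invertible_group A p^`().[c] ->
  exists2 d : R[i], 0 < d &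
    forall y : A, `|p.[c] - y| <= d -> exists2 h : A, `|h| <= e & p.[c + h] = y.
Proof.
move=> e0 [u [p'u _]].
pose q := p \Po ('X + c%:P).
have qE h : q.[h] = p.[c + h] by rewrite horner_comp !hornerE addrC.
have q0 : q.[0] = p.[c] by rewrite qE addr0.
have q1 : q`_1 = p^`().[c].
  have -> : q`_1 = q^`().[0] by rewrite horner_coef0 coef_deriv.
  by rewrite deriv_comp derivD derivX derivC addr0 mulr1 horner_comp !hornerE.
have [M M0 qM] := poly_second_order q.
(* [qM] gives T below the Lipschitz constant |u| M r, which must be at most
   1/2. *)
have [|r r0 [r1 re Mr]] := @exists_small _ e (`|u| * M * 2) e0.
  by rewrite !mulr_ge0.
(* This radius gives |T 0| <= |u| |p(c) - y| <= r / 2. *)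
exists (r / 2 / (`|u| + 1)) => [|y yd].
  by rewrite !divr_gt0// ltr_wpDl.
pose T h := h - u * (q.[h] - y).
have uq1 h : u * (q`_1 * h) = h by rewrite mulrA [u * _]mulrC q1 p'u mul1r.
have [|h k hr kr|h hr Th] := @half_contraction_fixpoint _ _ T r r0.
- rewrite /T add0r normrN q0 (le_trans (normrM_le _ _))//.
  rewrite (le_trans (ler_wpM2l _ yd))// mulrCA ler_piMr// ?divr_ge0 1?ltW//.
  by rewrite ltr_pdivrMr ?mul1r ?ltrDl ?ltr_wpDl.
- have -> : T h - T k = - (u * (q.[h] - q.[k] - q`_1 * (h - k))).
    by rewrite mulrBr uq1 /T; ring.
  rewrite normrN (le_trans (normrM_le _ _))//.
  rewrite (le_trans (ler_wpM2l _ (qM r h k r1 hr kr)))//.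
  have -> : `|u| * (M * r * `|h - k|) = `|h - k| / 2 * (`|u| * M * 2 * r).
    by field.
  by rewrite ler_piMr// divr_ge0.
exists h; first exact: le_trans hr re.
apply/eqP; rewrite -qE -subr_eq0 -(uq1 (_ - _)) mulrCA; apply/eqP.
move: Th => /eqP; rewrite /T subr_eq addrC -subr_eq subrr eq_sym => /eqP ->.
by rewrite mulr0.
Qed.

(** * Invertible values of polynomials *)

(** The size bound together with the condition on the n-th coefficient is the
    form of an invertible leading coefficient that differentiation preserves
    without computing the exact size of the derivative. *)
Lemma poly_invertible_value (R : realType) (A : comBanachAlg R[i])
    (n : nat) (p : {poly A}) (c : A) (e : R[i]) :
  dense_invertible_group A ->
  (size p <= n.+1)%N -> invertible_group A p`_n -> 0 < e ->
  exists2 h : A, `|h| < e & invertible_group A p.[c + h].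
Proof.
move=> /dense_normP dA.
elim: n p c e => [|n IH] p c e sp ip e0.
  exists 0; first by rewrite normr0.
  by move: ip; rewrite (size1_polyC sp) hornerC coefC.
have e20 : 0 < e / 2 by rewrite divr_gt0.
have [||h1 h1e ih1] := IH p^`() c (e / 2) _ _ e20.
- have [->|p0] := eqVneq p 0; first by rewrite deriv0 size_poly0.
  by rewrite -ltnS (leq_trans (lt_size_deriv p0)).
- move: ip => /invertible_com[u pu]; apply/invertible_com.
  exists (n.+1%:R^-1 *: u).
  rewrite coef_deriv -scaler_nat -scalerAl -scalerAr pu scalerA.
  by rewrite mulfV ?scale1r// pnatr_eq0.
have [d d0 pd] := poly_local_surjection e20 ih1.
have [y iy yd] := dA p.[c + h1] d d0.
have [h2 h2e ph2] := pd y (ltW yd).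
exists (h1 + h2); last by rewrite addrA ph2.
by rewrite [ltRHS]splitr (le_lt_trans (ler_normD _ _))// ltr_leD.
Qed.

(** * Integrality of the extension *)

Lemma in_qpoly_horner (A : comNzRingType) (alpha p : {poly A}) :
  (map_poly (in_qpoly alpha \o polyC) p).['qX] = in_qpoly alpha p.
Proof.
elim/poly_ind: p => [|p c IH]; first by rewrite !rmorph0 horner0.
by rewrite !rmorphD !rmorphM /= map_polyX map_polyC hornerMXaddC IH.
Qed.

(** Every coset is a polynomial expression over A in the coset of 'X, which is a
    root of the monic polynomial defining the quotient. *)
Lemma qpoly_integral (A : comNzRingType) (alpha : {poly A}) :
  integralRange (in_qpoly alpha \o polyC).
Proof.
pose iota := in_qpoly alpha \o polyC.
have int_map (p : {poly A}) : {in map_poly iota p : seq _, integralRange iota}.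
  by apply/integral_poly => i; rewrite coef_map; exact: integral_id.
move=> b; have -> : b = (map_poly iota (b : {poly A})).['qX].
  rewrite in_qpoly_horner; apply: val_inj.
  exact/esym/in_qpoly_small/size_mk_monic.
apply: (@integral_horner_root _ _ _ _ (map_poly iota (mk_monic alpha))) => //.
- exact/monic_map/monic_mk_monic.
- apply/rootP; rewrite in_qpoly_horner.
  by apply: val_inj; rewrite /= Pdiv.RingMonic.rmodpp ?monic_mk_monic.
Qed.

(** By the factor theorem p = q * ('X - b) over B, so that p(c) is the product
    of b - c and - q(c). *)
Lemma integral_sub_invertible (A B : comNzRingType) (iota : {rmorphism A -> B})
    (p : {poly A}) (b : B) (c : A) :
  root (map_poly iota p) b -> invertible_group A p.[c] ->
  invertible_group B (b - iota c).
Proof.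
move=> /factor_theorem[q pq] /invertible_com[d pd].
apply: (@invertible_divisor _ _ (- q.[iota c])).
apply/invertible_com; exists (iota d).
have := congr1 iota pd; rewrite rmorphM rmorph1 -horner_map pq hornerM.
by rewrite hornerXsubC => <-; ring.
Qed.

Theorem theorem4p2p2p1 (R : realType) (A : comBanachAlg R[i])
    (alpha : {poly A}) (t : R[i])
    (alpha_monic : alpha \is monic) (alpha_gt1 : (1 < size alpha)%N)
    (t_gt0 : 0 < t)
    (t_bound : \sum_(k < (size alpha).-1) `|alpha`_k| * t ^+ k
                 <= t ^+ (size alpha).-1) :
  dense_invertible_group A ->
  dense_invertible_group (arens_hoffman alpha_monic alpha_gt1 t_gt0 t_bound).
Proof.
move=> dA; apply/dense_normP => b e e0.
have [p p_monic pb] := qpoly_integral (b : {poly %/ alpha}).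
have [||h he ih] := @poly_invertible_value _ _ (size p).-1 p 0 e dA _ _ e0.
- exact: leqSpred.
- rewrite -lead_coefE (monicP p_monic); apply/invertible_com.
  by exists 1; rewrite mulr1.
rewrite add0r in ih.
pose iota := in_qpoly alpha \o polyC.
exists ((b : {poly %/ alpha}) - iota h).
  exact: (@integral_sub_invertible _ {poly %/ alpha} iota _ _ _ pb ih).
(* Only the constant coefficient of b - (b - iota h) survives, with weight
   t^0 = 1. *)
have iotaE : iota h = h%:P :> {poly A}.
  apply: in_qpoly_small; apply: leq_ltn_trans (size_polyC_leq1 h) _.
  exact: size_mk_monic_gt1.
rewrite subKr ah_normE -[(size alpha).-1]prednK ?ltn_predRL// big_ord_recl.
rewrite iotaE coefC expr0 mulr1 big1 ?addr0// => k _.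
by rewrite coefC normr0 mul0r.
Qed.
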